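(* Let $s,t\geq 1$ be integers and let $p,q,l$ be three distinct primes with $p,q$ odd, $p\equiv 3 \pmod 4$, $\mathrm{ord}_{p^s}(l)=\phi(p^s)/2$, $\mathrm{ord}_{q^t}(l)=\phi(q^t)$ and $\gcd(\phi(p^s),\phi(q^t))=2$. Let $0\leq j\leq t-1$. Then in the ring $\mathbb{F}_l[x]/\langle x^{p^sq^t}-1\rangle$: \[\chi_{sj}^2=(q-2)q^{t-j-1}\chi_{sj}+\phi(q^{t-j})\sum_{j<m\leq t}\chi_{sm}.\]
   Context: Here $\phi$ is Euler's phi function (with $\phi(1)=1$) and $\mathrm{ord}_m(k)$ is the multiplicative order of $k$ modulo $m$. Put $n=p^sq^t$. For an integer $\gamma$, $C_\gamma=\{\gamma l^r \bmod n: r\geq 0\}\subseteq \mathbb{Z}_n$ is the $l$-cyclotomic coset modulo $n$ containing $\gamma$. For $0\leq j\leq t$ set $C_{sj}=C_{p^sq^j}$, so $C_{st}=C_0=\{0\}$, and define the element $\chi_{sj}=\sum_{\alpha\in C_{sj}}x^\alpha$ of $\mathbb{F}_l[x]/\langle x^{n}-1\rangle$; in particular $\chi_{st}=1$. Integer coefficients are read in $\mathbb{F}_l$. *)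

(* Defs.v *)
From mathcomp Require Import all_boot all_order all_algebra.
From mathcomp Require Import cyclic.

Set Implicit Arguments.
Unset Strict Implicit.
Unset Printing Implicit Defensive.

Import GRing.Theory.

Fact mul_order_exists m k :
  exists d, (0 < d) && ((k ^ d == 1 %[mod m]) || ~~ coprime m k).
Proof.
case cop: (coprime m k); last by exists 1; rewrite orbT.
case: m cop => [|m] cop.
  by exists 1; move: cop; rewrite /coprime gcd0n => /eqP->.
exists (totient m.+1); rewrite totient_gt0 /= orbF.
by apply/eqP/Euler_exp_totient; rewrite coprime_sym.
Qed.

(* The least d > 0 with k ^ d = 1 mod m. The order only makes sense when k is
   coprime to m; the value is 1 by convention otherwise. *)
Definition mul_order (m k : nat) : nat := ex_minn (mul_order_exists m k).

(* Exponents r < n suffice because there are at most n residues modulo n: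
   see cyclotomic_cosetP. *)
Definition cyclotomic_coset (n l gamma : nat) : {set 'I_n} :=
  [set a : 'I_n | [exists r : 'I_n, a == gamma * l ^ r %% n :> nat]].

Lemma cyclotomic_cosetP n l gamma (a : 'I_n) :
  reflect (exists r : nat, a = gamma * l ^ r %% n :> nat)
          (a \in cyclotomic_coset n l gamma).
Proof.
rewrite inE; apply: (iffP existsP) => [[r /eqP ar]|[r ar]]; first by exists r.
have n_gt0 : 0 < n by case: n a {ar} => [[]|].
pose f (x : 'I_n) := Ordinal (ltn_pmod (x * l) n_gt0).
pose x0 := Ordinal (ltn_pmod gamma n_gt0).
have fE k : iter k f x0 = gamma * l ^ k %% n :> nat.
  elim: k => [|k IHk] /=; first by rewrite muln1.
  by rewrite IHk modnMml -mulnA -expnSr.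
have fa : fconnect f x0 a.
  by rewrite (_ : a = iter r f x0) ?fconnect_iter //; apply/val_inj; rewrite /= fE.
have lt_n : findex f x0 a < n.
  by rewrite -[X in _ < X]card_ord (leq_trans (findex_max fa)) ?max_card.
by exists (Ordinal lt_n); rewrite -fE iter_findex.
Qed.

Local Open Scope ring_scope.

Lemma mk_monic_XnB1 (R : nzRingType) n :
  (0 < n)%N -> mk_monic ('X^n - 1) = 'X^n - 1 :> {poly R}.
Proof.
by move=> n0; rewrite /mk_monic -polyC1 size_XnsubC // monicXnsubC // ltnS n0.
Qed.

(* For n > 0 this is F_l[x]/<x^n - 1>: see mk_monic_XnB1. *)
Definition cyclic_ring (l n : nat) := {poly %/ ('X^n - 1 : {poly 'F_l})}.

(* chi_{sj}, the sum of x^alpha over the coset of p^s q^j mod p^s q^t. *)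
Definition chi (p q l s t j : nat) : cyclic_ring l (p ^ s * q ^ t) :=
  \sum_(a in cyclotomic_coset (p ^ s * q ^ t) l (p ^ s * q ^ j))
    'qX ^+ a.

Lemma chi_t (p q l s t : nat) :
  (0 < p ^ s * q ^ t)%N -> chi p q l s t t = 1.
Proof.
move=> n_gt0; pose z : 'I_(p ^ s * q ^ t) := Ordinal n_gt0.
rewrite /chi (big_pred1 z) ?expr0 // => a.
apply/cyclotomic_cosetP/eqP => [[r]|->]; last by exists 0%N; rewrite muln1 modnn.
by rewrite modnMr => a0; apply/val_inj.
Qed.

(* Main.v *)
(** Since [l] is a primitive root modulo [q ^ t], the coset of [p ^ s * q ^ j]
    consists of the multiples [p ^ s * q ^ j * k] with [k] prime to [q].  Hence
    [chi_j = S_j - S_(j+1)] for [j < t], where [S_j] is the sum of all powers of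
    [x ^ (p ^ s * q ^ j)], i.e. of the elements of a cyclic group of order
    [q ^ (t - j)], and [chi_t = S_t = 1]. For [i <= j] one has
    [S_i * S_j = q ^ (t - j) S_i], and the sum of the [chi_m] with [m > j]
    telescopes to [S_(j+1)], so the formula follows by expanding
    [(S_j - S_(j+1)) ^ 2]. *)
Require Import Defs.
From mathcomp Require Import all_boot all_order all_algebra ring.

Import GRing.Theory.
Local Open Scope ring_scope.

Section MultiplicativeOrder.

Local Open Scope nat_scope.

Lemma mul_order_le m l d :
  0 < d -> l ^ d = 1 %[mod m] -> mul_order m l <= d.
Proof.
move=> d0 ld; rewrite /mul_order; case: ex_minnP => e _; apply.
by rewrite d0 ld eqxx.
Qed.

Lemma expn_mod_inj m l r1 r2 : 0 < l -> coprime m l ->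
  r1 < mul_order m l -> r2 < mul_order m l ->
  l ^ r1 = l ^ r2 %[mod m] -> r1 = r2.
Proof.
move=> l0 cop; wlog lt12 : r1 r2 / r1 < r2.
  move=> IH h1 h2 E; case: (ltngtP r1 r2) => // lt; first exact: IH.
  by apply/esym/IH.
move=> _ h2 /esym/eqP; rewrite eqn_mod_dvd ?leq_pexp2l ?(ltnW lt12) //.
(* The factor [l ^ r1] is prime to [m] and cancels, leaving [l ^ (r2 - r1) = 1] modulo [m] with a
   positive exponent below the order. *)
rewrite -{1}(subnKC (ltnW lt12)) expnD -{2}[l ^ r1]muln1 -mulnBr.
rewrite Gauss_dvdr ?coprimeXr // -eqn_mod_dvd ?expn_gt0 ?l0 // => /eqP E.
have := @mul_order_le m l (r2 - r1); rewrite subn_gt0 lt12 => /(_ isT E).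
by rewrite leqNgt (leq_ltn_trans (leq_subr _ _) h2).
Qed.

(** Counting: the powers [l ^ r] with [r < totient m] are pairwise distinct units modulo [m], as
    many as there are units, so they exhaust them. *)
Lemma primitive_root_expn m l k : 0 < m -> 0 < l -> coprime m l ->
  mul_order m l = totient m -> coprime m k -> exists r, l ^ r = k %[mod m].
Proof.
move=> m0 l0 cop ord copk.
pose h (r : 'I_(totient m)) : 'I_m := Ordinal (ltn_pmod (l ^ r) m0).
pose A := [set x : 'I_m | coprime m x].
have cardA : #|A| = totient m.
  by rewrite totient_count_coprime big_mkord -sum1dep_card big_mkcond.
have hI : injective h.
  move=> r1 r2 /(congr1 val) /= E; apply/val_inj.
  by apply: (@expn_mod_inj m l) => //; rewrite ord ltn_ord.
have /eqP hA : h @: setT == A.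
  rewrite eqEcard cardA card_imset // cardsT card_ord leqnn andbT.
  by apply/subsetP => _ /imsetP[r _ ->]; rewrite inE /= coprime_modr coprimeXr.
have : Ordinal (ltn_pmod k m0) \in A by rewrite inE /= coprime_modr.
by rewrite -hA => /imsetP[r _ /(congr1 val) /= E]; exists r.
Qed.

(** The order of [l] is known only modulo the larger [m']. A number prime to [m] is prime to [m'],
    hence a power of [l] modulo [m'], and this congruence descends to the divisor [m]. *)
Lemma mem_cyclotomic_coset_primitive_root n d m m' l (a : 'I_n) :
  n = d * m -> 0 < m -> m %| m' -> 0 < m' -> 0 < l -> coprime m' l ->
  mul_order m' l = totient m' -> (forall k, coprime m k = coprime m' k) ->
  reflect (exists2 k, k < m & coprime m k /\ a = d * k :> nat)
    (a \in cyclotomic_coset n l d).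
Proof.
move=> nE m0 mm' m'0 l0 cop ord copE.
apply: (iffP (cyclotomic_cosetP _ _ _)) => [[r ->]|[k ltkm [copk ->]]].
  exists (l ^ r %% m); first by rewrite ltn_pmod.
  by rewrite coprime_modr coprimeXr ?copE // muln_modr nE.
have [|r E] := @primitive_root_expn m' l k m'0 l0 cop ord.
  by rewrite -copE.
exists r; rewrite nE -muln_modr; congr (d * _).
by rewrite -(modn_dvdm _ mm') E modn_dvdm // modn_small.
Qed.

End MultiplicativeOrder.

Section GeometricSums.

Variable R : comNzRingType.

Definition geom_sum (m : nat) (z : R) := \sum_(k < m) z ^+ k.

(** Multiplication by [z] shifts the powers cyclically, [z ^+ m = 1] bringing the last one back to
    the first. *)
Lemma geom_sum_invariant m z i : z ^+ m = 1 ->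
  z ^+ i * geom_sum m z = geom_sum m z.
Proof.
case: m => [|m] zm; first by rewrite /geom_sum big_ord0 mulr0.
elim: i => [|i IH]; first by rewrite mul1r.
rewrite exprS -mulrA IH.
rewrite /geom_sum mulr_sumr big_ord_recr [RHS]big_ord_recl /= -exprS zm addrC.
by congr (_ + _); apply: eq_bigr => k _; rewrite -exprS.
Qed.

(** Each of the [m'] terms of the first factor is a power of [z], which the second factor
    absorbs. *)
Lemma geom_sumM m m' e z : z ^+ m = 1 ->
  geom_sum m' (z ^+ e) * geom_sum m z = m'%:R * geom_sum m z.
Proof.
move=> zm; rewrite {1}/geom_sum mulr_suml.
under eq_bigr do rewrite -exprM geom_sum_invariant //.
by rewrite sumr_const card_ord mulr_natl.
Qed.

Lemma geom_sum_ndvd q m z : (0 < q)%N ->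
  \sum_(k < q * m | ~~ (q %| k)%N) z ^+ k =
    geom_sum (q * m) z - geom_sum m (z ^+ q).
Proof.
move=> q0; rewrite {1}/geom_sum.
rewrite [in RHS](bigID (fun k : 'I_(q * m) => (q %| k)%N)) /=.
rewrite [in RHS]addrC; apply/(canRL (addrK _)); congr (_ + _).
have lt1 (k : 'I_m) : (q * k < q * m)%N by rewrite ltn_pmul2l.
have lt2 (k : 'I_(q * m)) : (k %/ q < m)%N.
  by rewrite ltn_divLR // [leqRHS]mulnC.
(* The multiples of [q] below [q * m] are the [q * k] with [k < m]. *)
rewrite (reindex_onto (fun k => Ordinal (lt1 k)) (fun k => Ordinal (lt2 k))) /=.
  apply: eq_big => [k|k _]; last by rewrite exprM.
  by rewrite dvdn_mulr //= -val_eqE /= mulKn // eqxx.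
by move=> k qk; apply/val_inj; rewrite /= mulnC divnK.
Qed.

(** Meant for [a = S_j], [b = S_(j+1)] and [N = q ^ (t - j - 1)]: both sides reduce to
    [(q - 2) * N * a + N * b]. *)
Lemma sqrB_geom_sum q N (a b : R) : (1 < q)%N ->
  a * a = (q * N)%:R * a -> b * b = N%:R * b -> b * a = N%:R * a ->
  (a - b) ^+ 2 = (a - b) *+ ((q - 2) * N) + b *+ (q.-1 * N).
Proof.
move=> q1 aa bb ba; rewrite -subn1 -[(a - b) *+ _]mulr_natr -[b *+ _]mulr_natr.
rewrite !natrM !natrB ?(ltnW q1) //.
have -> : (a - b) ^+ 2 = a * a - b * a *+ 2 + b * b by ring.
by rewrite aa bb ba natrM; ring.
Qed.

End GeometricSums.

Arguments geom_sum {R} m%_N z.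

Lemma qpolyX_expn (l n : nat) : (0 < n)%N -> ('qX : cyclic_ring l n) ^+ n = 1.
Proof.
move=> n0; apply/eqP; rewrite -subr_eq0 -rmorphXn.
rewrite -(rmorph1 (in_qpoly _)) -rmorphB.
apply/eqP/val_inj; rewrite /= mk_monic_XnB1 //.
by rewrite Pdiv.RingMonic.rmodpp ?monicXnsubC.
Qed.

Lemma sum_cyclotomic_coset (V : nmodType) (F : nat -> V) n d m m' l :
  n = (d * m)%N -> (0 < d)%N -> (0 < m)%N -> (m %| m')%N -> (0 < m')%N ->
  (0 < l)%N -> coprime m' l -> mul_order m' l = totient m' ->
  (forall k, coprime m k = coprime m' k) ->
  \sum_(a in cyclotomic_coset n l d) F a =
    \sum_(k < m | coprime m k) F (d * k)%N.
Proof.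
move=> nE d0 m0 mm' m'0 l0 cop ord copE.
have memP a := @mem_cyclotomic_coset_primitive_root n d m m' l a
  nE m0 mm' m'0 l0 cop ord copE.
have lt1 (k : 'I_m) : (d * k < n)%N by rewrite nE ltn_pmul2l.
have lt2 (a : 'I_n) : (a %/ d < m)%N by rewrite ltn_divLR // [leqRHS]mulnC -nE.
rewrite (reindex_onto (fun k => Ordinal (lt1 k)) (fun a => Ordinal (lt2 a))) /=.
  apply: eq_bigl => k; rewrite -val_eqE /= mulKn // eqxx andbT.
  apply/memP/idP => [[k' _ [copk' /= /eqP]]|copk]; last by exists k.
  by rewrite eqn_pmul2l // => /eqP->.
by move=> a /memP[k _ [_ aE]]; apply/val_inj; rewrite /= aE mulKn.
Qed.

Lemma chi_geom_sum p q l s t j : prime p -> prime q -> prime l -> q <> l ->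
  mul_order (q ^ t) l = totient (q ^ t) -> (j < t)%N ->
  chi p q l s t j = geom_sum (q ^ (t - j)) ('qX ^+ (p ^ s * q ^ j))
                  - geom_sum (q ^ (t - j.+1)) ('qX ^+ (p ^ s * q ^ j.+1)).
Proof.
move=> p_prime q_prime l_prime q_neq_l ord ltjt.
have [p0 q0 l0] : [/\ (0 < p)%N, (0 < q)%N & (0 < l)%N] by rewrite !prime_gt0.
have copX e k : (0 < e)%N -> coprime (q ^ e) k = ~~ (q %| k)%N.
  by move=> e0; rewrite coprime_pexpl ?prime_coprime.
have cop : coprime (q ^ t) l.
  by apply: coprimeXl; rewrite prime_coprime ?dvdn_prime2 //; apply/eqP.
(* Here [m = q ^ (t - j)] and [m' = q ^ t]; as [j < t], both exponents are positive, so being prime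
   to either means not being divisible by [q]. *)
rewrite /chi (@sum_cyclotomic_coset _ (fun a => 'qX ^+ a) _ _
  (q ^ (t - j)) (q ^ t));
  rewrite ?muln_gt0 ?expn_gt0 ?p0 ?q0 ?dvdn_exp2l ?leq_subr //; last first.
- by move=> k; rewrite !copX ?subn_gt0 // (leq_ltn_trans _ ltjt).
- by rewrite -mulnA -expnD subnKC // ltnW.
rewrite (_ : q ^ (t - j) = q * q ^ (t - j.+1))%N; last by rewrite -expnS subnSK.
rewrite (_ : p ^ s * q ^ j.+1 = p ^ s * q ^ j * q)%N; last first.
  by rewrite -mulnA -expnSr.
rewrite (exprM _ _ q) -geom_sum_ndvd //.
apply: eq_big => k; last by rewrite exprM.
by rewrite /= -(copX (t - j)%N) ?subn_gt0 // -(subnSK ltjt) expnS.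
Qed.

Theorem theorem4p4 (s t p q l j : nat)
  (s_ge1 : (1 <= s)%N) (t_ge1 : (1 <= t)%N)
  (p_prime : prime p) (q_prime : prime q) (l_prime : prime l)
  (p_neq_q : p <> q) (p_neq_l : p <> l) (q_neq_l : q <> l)
  (p_odd : odd p) (q_odd : odd q)
  (p_mod4 : (p = 3 %[mod 4])%N)
  (ord_p : mul_order (p ^ s) l = (totient (p ^ s) %/ 2)%N)
  (ord_q : mul_order (q ^ t) l = totient (q ^ t))
  (gcd_phi : gcdn (totient (p ^ s)) (totient (q ^ t)) = 2%N)
  (j_le : (j <= t - 1)%N) :
  chi p q l s t j ^+ 2 =
    ((q - 2) * q ^ (t - j - 1))%:R *: chi p q l s t j
    + (totient (q ^ (t - j)))%:R
        *: \sum_(j.+1 <= m < t.+1) chi p q l s t m.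
Proof.
have ltjt : (j < t)%N by rewrite -(prednK t_ge1) ltnS -subn1.
have n0 : (0 < p ^ s * q ^ t)%N by rewrite muln_gt0 !expn_gt0 !prime_gt0.
pose S i : cyclic_ring l (p ^ s * q ^ t) :=
  geom_sum (q ^ (t - i)) ('qX ^+ (p ^ s * q ^ i)).
have chiE i : (i < t)%N -> chi p q l s t i = S i - S i.+1.
  exact: chi_geom_sum.
have St : S t = 1 by rewrite /S subnn /geom_sum big_ord1.
have sum_chi : \sum_(j.+1 <= m < t.+1) chi p q l s t m = S j.+1.
  (* The term [m = t] is split off because [chiE] covers only [i < t]; its value 1 is [S t], which
     cancels the end of the telescope. *)
  rewrite big_nat_recr //= chi_t // -St.
  rewrite (telescope_sumr_eq (fun i => - S i)) // => [|i /andP[_ ltit]].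
    by rewrite opprK addrAC addNr add0r.
  by rewrite chiE // opprK; exact: addrC.
rewrite sum_chi chiE // !scaler_nat.
set N := (q ^ (t - j.+1))%N.
have NE : (q ^ (t - j) = q * N)%N by rewrite -expnS subnSK.
have root i : (i <= t)%N ->
    ('qX : cyclic_ring l (p ^ s * q ^ t)) ^+ (p ^ s * q ^ i) ^+ (q ^ (t - i))
    = 1.
  by move=> leit; rewrite -exprM -mulnA -expnD subnKC // qpolyX_expn.
have S00 : S j * S j = (q * N)%:R * S j.
  by rewrite -NE -(@geom_sumM _ _ _ 1) ?root ?expr1 // ltnW.
have S11 : S j.+1 * S j.+1 = N%:R * S j.+1.
  by rewrite -(@geom_sumM _ _ _ 1) ?root ?expr1.
have S10 : S j.+1 * S j = N%:R * S j.
  (* The exponent is [q] because the generator of [S j.+1] is the [q]-th power of that of [S j]. *)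
  rewrite -(@geom_sumM _ _ _ q) ?root ?(ltnW ltjt) //.
  by rewrite -exprM -mulnA -expnSr.
(* Both coefficients are brought to multiples of [N], with [totient (q ^ (t - j)) = q.-1 * N]. *)
rewrite -subnDA addn1 -/N totient_pfactor ?subn_gt0 // -subnS -/N.
exact: sqrB_geom_sum (prime_gt1 q_prime) S00 S11 S10.
Qed.
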